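(* Let $G$ be a finite group with irreducible modules $G^\lambda$, $\lambda\in\Lambda(G)$, over $\mathbb{C}$, and let $V$ be a fixed finite-dimensional $G$-module over $\mathbb{C}$ such that the action of $G$ on $V$ is faithful and the dual module $V^*$ is isomorphic to $V$ as a $G$-module. For $\mu\in\Lambda(G)$ let $m^\mu(t)=\sum_{k\ge 0} m_k^\mu t^k$ be the Poincaré series for the multiplicities $m_k^\mu$ ($k\ge 0$) of $G^\mu$ in the tensor powers $V^{\otimes k}$, i.e. in $T(V)=\bigoplus_{k\ge 0}V^{\otimes k}$. Let $A=(a_{\mu,\lambda})$ be the adjacency matrix of the representation graph $\mathcal{R}_V(G)$, and let $M^\mu$ be the matrix $I-tA$ with the column indexed by $\mu$ replaced by the column vector $\underline{\delta}=(1,0,\dots,0)^{T}$, whose entry $1$ is in the row indexed by the trivial module. Then for every $\mu\in\Lambda(G)$ $$ m^\mu(t)=\frac{\det(M^\mu)}{\det(I-tA)}=\frac{\det(M^\mu)}{\prod_{g\in\Gamma}\bigl(1-\chi_V(g)t\bigr)}, $$ where $\Gamma$ is a set of conjugacy class representatives of $G$ and $\chi_V$ is the character of $V$.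
   Context: $\Lambda(G)$ indexes the isomorphism classes of finite-dimensional irreducible $G$-modules $G^\lambda$ over $\mathbb{C}$; the index $0\in\Lambda(G)$ denotes the one-dimensional trivial module $G^0$. The elements of $\Lambda(G)$ are ordered with $0$ first, and matrices indexed by $\Lambda(G)$ use this order for rows and columns. The representation graph $\mathcal{R}_V(G)$ has nodes indexed by $\Lambda(G)$ and $a_{\mu,\lambda}$ edges from $\mu$ to $\lambda$, where $a_{\mu,\lambda}$ is the multiplicity of $G^\lambda$ in $G^\mu\otimes V$, i.e. $G^\mu\otimes V\cong\bigoplus_{\lambda\in\Lambda(G)}a_{\mu,\lambda}G^\lambda$. The multiplicity of $G^\mu$ in $V^{\otimes k}$ is $m_k^\mu=\dim \mathrm{Hom}_G(G^\mu,V^{\otimes k})$, with $V^{\otimes 0}=\mathbb{C}$ identified with the trivial module $G^0$, so $m_0^\mu=\delta_{\mu,0}$. $I$ is the identity matrix of the appropriate size. The identities hold for formal power series in $t$ (the denominators have constant term $1$). *)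

(* Defs.v *)
From HB Require Import structures.
From mathcomp Require Import all_boot all_order all_algebra all_fingroup.
From mathcomp Require Import mxrepresentation character.
From mathcomp Require Import boolp reals complex.
#[local] Set Warnings "-redundant-canonical-projection".
Set Implicit Arguments.
Unset Strict Implicit.
Unset Printing Implicit Defensive.
Import GRing.Theory.
Local Open Scope ring_scope.

(* The ring K[[t]] of formal power series over a field K. *)

Record fps (K : Type) := Fps {fps_coef : nat -> K}.

HB.instance Definition _ (K : Type) := gen_eqMixin (fps K).
HB.instance Definition _ (K : Type) := gen_choiceMixin (fps K).

Section FpsRing.
Variable K : fieldType.
Implicit Types f g h : fps K.

Lemma fpsP f g : (forall n, fps_coef f n = fps_coef g n) -> f = g.
Proof. by case: f g => [f] [g] fg; congr Fps; apply: funext. Qed.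

Definition fps_zero : fps K := Fps (fun=> 0).
Definition fps_opp f := Fps (fun n => - fps_coef f n).
Definition fps_add f g := Fps (fun n => fps_coef f n + fps_coef g n).

Fact fps_addA : associative fps_add.
Proof. by move=> f g h; apply: fpsP => n; apply: addrA. Qed.
Fact fps_addC : commutative fps_add.
Proof. by move=> f g; apply: fpsP => n; apply: addrC. Qed.
Fact fps_add0 : left_id fps_zero fps_add.
Proof. by move=> f; apply: fpsP => n; apply: add0r. Qed.
Fact fps_addN : left_inverse fps_zero fps_opp fps_add.
Proof. by move=> f; apply: fpsP => n; apply: addNr. Qed.

HB.instance Definition _ :=
  GRing.isZmodule.Build (fps K) fps_addA fps_addC fps_add0 fps_addN.

Definition fpsC (c : K) : fps K := Fps (fun n => if n is 0%N then c else 0).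
Definition fpsX : fps K := Fps (fun n => (n == 1)%:R).
Definition fps_mul f g :=
  Fps (fun n => \sum_(i < n.+1) fps_coef f i * fps_coef g (n - i)%N).

(* The ring laws are transferred from {poly K} through truncation. *)
Let trunc n f : {poly K} := \poly_(i < n) fps_coef f i.

Let coef_mul_trunc m n f g : (m < n)%N ->
  fps_coef (fps_mul f g) m = (trunc n f * trunc n g)`_m.
Proof.
move=> ltmn; rewrite coefM; apply: eq_bigr => i _; rewrite !coef_poly.
by rewrite (leq_ltn_trans _ ltmn) ?(leq_ltn_trans (leq_subr _ _) ltmn) // -ltnS.
Qed.

Let truncM m n f g : (m < n)%N ->
  (trunc n (fps_mul f g))`_m = (trunc n f * trunc n g)`_m.
Proof. by move=> ltmn; rewrite coef_poly ltmn (coef_mul_trunc _ _ ltmn). Qed.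

Fact fps_mulC : commutative fps_mul.
Proof. by move=> f g; apply: fpsP => n; rewrite !(coef_mul_trunc _ _ (ltnSn n)) mulrC. Qed.

Fact fps_mulA : associative fps_mul.
Proof.
move=> f g h; apply: fpsP => n; rewrite !(coef_mul_trunc _ _ (ltnSn n)).
transitivity ((trunc n.+1 f * (trunc n.+1 g * trunc n.+1 h))`_n).
  rewrite !coefM; apply: eq_bigr => i _; congr (_ * _).
  by rewrite truncM // ltnS leq_subr.
rewrite mulrA !coefM; apply: eq_bigr => i _; congr (_ * _).
by rewrite truncM.
Qed.

Fact fps_mul1 : left_id (fpsC 1) fps_mul.
Proof.
move=> f; apply: fpsP => n /=; rewrite big_ord_recl /= mul1r subn0.
by rewrite big1 ?addr0 // => i _; rewrite mul0r.
Qed.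

Fact fps_mulDl : left_distributive fps_mul fps_add.
Proof.
move=> f g h; apply: fpsP => n /=; rewrite -big_split /=.
by apply: eq_bigr => i _; rewrite mulrDl.
Qed.

Fact fps_oner_neq0 : fpsC 1 != 0 :> fps K.
Proof.
by apply/eqP => /(congr1 (fun f => fps_coef f 0%N)) /eqP; rewrite (oner_eq0 K).
Qed.

HB.instance Definition _ := GRing.Zmodule_isComNzRing.Build (fps K)
  fps_mulA fps_mulC fps_mul1 fps_mulDl fps_oner_neq0.

Definition fps_unit := [pred f : fps K | fps_coef f 0%N != 0].

(* The first n coefficients b_i of 1 / f, from sum_(i <= m) f_(m - i) b_i =
   (m == 0). *)
Fixpoint fps_inv_seq f n : seq K :=
  if n is m.+1 then
    let s := fps_inv_seq f m in
    rcons s ((fps_coef f 0%N)^-1 *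
             ((m == 0%N)%:R - \sum_(i < m) fps_coef f (m - i)%N * s`_i))
  else [::].

Definition fps_inv f :=
  if f \in fps_unit then Fps (fun n => (fps_inv_seq f n.+1)`_n) else f.

Let size_inv_seq f n : size (fps_inv_seq f n) = n.
Proof. by elim: n => //= n IHn; rewrite size_rcons IHn. Qed.

Let nth_inv_seq f n i : (i < n)%N ->
  (fps_inv_seq f n)`_i = (fps_inv_seq f i.+1)`_i.
Proof.
elim: n => // n IHn; rewrite ltnS leq_eqVlt => /predU1P[->//|ltin].
by rewrite [LHS]/= nth_rcons size_inv_seq ltin IHn.
Qed.

Fact fps_mulVf : {in fps_unit, left_inverse 1 fps_inv *%R}.
Proof.
move=> f f_unit; apply: fpsP => n; rewrite /fps_inv f_unit.
have f0 : fps_coef f 0%N != 0 by [].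
have rev_sum : \sum_(i < n) (fps_inv_seq f i.+1)`_i * fps_coef f (n - i)%N =
    \sum_(i < n) fps_coef f (n - i)%N * (fps_inv_seq f n)`_i.
  by apply: eq_bigr => i _; rewrite mulrC (nth_inv_seq _ (ltn_ord i)).
rewrite [LHS]big_ord_recr; cbn [fps_coef]; rewrite [X in X + _ = _]rev_sum.
rewrite subnn [fps_inv_seq f n.+1]/= nth_rcons size_inv_seq ltnn eqxx.
by rewrite mulrAC mulVf // mul1r addrC subrK; case: n {rev_sum}.
Qed.

Fact fps_unitP f g : g * f = 1 -> f \in fps_unit.
Proof.
move=> /(congr1 (fun h => fps_coef h 0%N)).
rewrite [LHS]big_ord_recl big_ord0 /= addr0 => gf1.
by rewrite inE; apply/eqP => f0; move/eqP: gf1; rewrite f0 mulr0 eq_sym oner_eq0.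
Qed.

Fact fps_inv_out : {in [predC fps_unit], fps_inv =1 id}.
Proof. by move=> f /negbTE nf; rewrite /fps_inv nf. Qed.

HB.instance Definition _ := GRing.ComNzRing_hasMulInverse.Build (fps K)
  fps_mulVf fps_unitP fps_inv_out.

End FpsRing.

Arguments fpsX {K}.

(* A finite-dimensional G-module is a matrix representation acting on row
   vectors; isomorphism of modules is mx_rsim. *)

Section Modules.
Variables (K : fieldType) (gT : finGroupType) (G : {group gT}).

Lemma triv_mx_repr : mx_repr G (fun _ : gT => 1%:M : 'M[K]_1).
Proof. by split=> // x y _ _; rewrite mulmx1. Qed.
Definition triv_grepr := Representation (MxRepresentation triv_mx_repr).

Section Dual.
Variable V : representation K G.

Lemma dual_mx_repr : mx_repr G (fun g => (V g^-1%g)^T).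
Proof.
split=> [|x y Gx Gy]; first by rewrite invg1 repr_mx1 trmx1.
by rewrite invMg repr_mxM ?groupV // trmx_mul.
Qed.
Definition dual_grepr := Representation (MxRepresentation dual_mx_repr).

End Dual.

Definition tensor_grepr (V W : representation K G) :=
  Representation (prod_repr V W).

Fixpoint tpower_grepr (V : representation K G) (k : nat) :=
  if k is k'.+1 then tensor_grepr (tpower_grepr V k') V else triv_grepr.

(* Hom_G(V, W): since vectors are rows, f : V -> W is u |-> u *m f. *)
Definition hom_defect (V W : representation K G) (g : gT)
    (f : 'M[K]_(rdegree V, rdegree W)) : 'M[K]_(rdegree V, rdegree W) :=
  V g *m f - f *m W g.

Lemma hom_defect_linear V W g : linear (@hom_defect V W g).
Proof.
move=> a f h; rewrite /hom_defect mulmxDr mulmxDl -scalemxAr -scalemxAl.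
by rewrite scalerBr opprD addrACA.
Qed.
HB.instance Definition _ V W g :=
  GRing.isSemilinear.Build K _ _ _ (@hom_defect V W g)
    (GRing.semilinear_linear (@hom_defect_linear V W g)).

Definition homG (V W : representation K G) :
    {vspace 'M[K]_(rdegree V, rdegree W)} :=
  (\bigcap_(g in G) lker (linfun (@hom_defect V W g)))%VS.


Lemma homGP (V W : representation K G) (f : 'M_(rdegree V, rdegree W)) :
  reflect {in G, forall g, V g *m f = f *m W g} (f \in homG V W).
Proof.
rewrite memvE; apply: (iffP subv_bigcapP) => fP g Gg.
  have := fP g Gg; rewrite -memvE memv_ker lfunE /= /hom_defect.
  by rewrite subr_eq0 => /eqP.
by rewrite -memvE memv_ker lfunE /= /hom_defect (fP g Gg) subrr.
Qed.

(* irr lists every irreducible G-module exactly once up to isomorphism, the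
   trivial one first. *)
Definition irreducible_system r (irr : 'I_r.+1 -> representation K G) : Prop :=
  [/\ forall l, mx_irreducible (irr l),
      forall l m, mx_rsim (irr l) (irr m) -> l = m,
      forall W : representation K G,
        mx_irreducible W -> exists l, mx_rsim W (irr l)
    & mx_rsim (irr ord0) triv_grepr].

(* A m l is the multiplicity of irr l in irr m (x) V, that is, the number of
   edges from m to l in the representation graph of V. *)
Definition rep_graph_adjacency r (irr : 'I_r.+1 -> representation K G)
    (V : representation K G) (A : 'M[nat]_r.+1) : Prop :=
  forall m, mx_rsim (tensor_grepr (irr m) V)
    (\big[@dadd_grepr K gT G/grepr0]_l muln_grepr (irr l) (A m l)).

Definition mult_tpower (U V : representation K G) (k : nat) : nat :=
  \dim (homG U (tpower_grepr V k)).

Definition poincare_series (U V : representation K G) : fps K :=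
  Fps (fun k => (mult_tpower U V k)%:R).

End Modules.

Section Matrices.
Variables (K : fieldType) (r : nat) (A : 'M[nat]_r.+1).

Definition one_sub_tA : 'M[fps K]_r.+1 :=
  1%:M - fpsX *: map_mx (fun a : nat => a%:R) A.

Definition column_replaced (mu : 'I_r.+1) : 'M[fps K]_r.+1 :=
  \matrix_(i, j) if j == mu then (i == ord0)%:R else one_sub_tA i j.

End Matrices.

(* Main.v *)
Require Import Defs.
From HB Require Import structures.
From mathcomp Require Import all_boot all_order all_algebra all_fingroup.
From mathcomp Require Import pgroup mxrepresentation character.
From mathcomp Require Import reals complex.
Set Implicit Arguments.
Unset Strict Implicit.
Unset Printing Implicit Defensive.
Import GRing.Theory.
Local Open Scope ring_scope.

(* Averaging f |-> U(g)^-1 f W(g) over G projects Hom(U, W) onto Hom_G(U, W), so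
   the trace of this projector gives dim Hom_G(U, W) as the inner product of the
   characters of U and W.  As V is self-dual, chi_V(g^-1) = chi_V(g), and moving
   one factor chi_V across the inner product yields
   m_(k+1)^l = sum_j a_(l, j) m_k^j, that is, (I - tA) m(t) = delta: Cramer's
   rule gives the first equality.  The character table X satisfies
   A X = X diag(chi_V(g)) and is invertible, being square with orthonormal rows,
   whence the product formula for det(I - tA). *)

(** * Traces of operators on matrix spaces *)

Lemma mxtrace_lin_mulmx (K : fieldType) m n (A : 'M[K]_m) (B : 'M[K]_n) :
  \tr (lin_mx (mulmxr B \o mulmx A)) = \tr A * \tr B.
Proof.
rewrite /mxtrace (reindex _ (curry_mxvec_bij m n)) big_distrlr pair_bigA /=.
apply: eq_bigr => -[i j] _ /=; rewrite mxE /= vec_mx_delta mxvecE.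
(* Splitting the elementary matrix into a column times a row turns its image into column [i] of [A]
   times row [j] of [B], whose [(i, j)] entry is [A i i * B j j]. *)
rewrite -(mul_delta_mx (0 : 'I_1)) mulmxA -colE -mulmxA -rowE.
by rewrite mxE big_ord1 !mxE.
Qed.

(** Coordinates in a basis of [U] factor the projector as [C *m B] with [B *m C = 1], and the trace
    does not change when the factors are swapped. *)
Lemma mxtrace_proj_vspace (K : fieldType) m n (U : {vspace 'M[K]_(m, n)})
    (f : {linear 'M[K]_(m, n) -> 'M[K]_(m, n)}) :
    (forall v, f v \in U) -> {in U, forall v, f v = v} ->
  \tr (lin_mx f) = (\dim U)%:R.
Proof.
move=> fU fK; set X := vbasis U.
pose B := \matrix_(i < \dim U) mxvec X`_i.
pose C := \matrix_(k < m * n, i < \dim U)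
  coord X i (f (vec_mx (delta_mx 0 k))).
have defP : lin_mx f = C *m B.
  apply/row_matrixP => k; rewrite row_mul rowE.
  rewrite -[delta_mx 0 k]vec_mxK mul_vec_lin (coord_vbasis (fU _)) linear_sum.
  rewrite mulmx_sum_row; apply: eq_bigr => i _.
  by rewrite linearZ rowK !mxE.
have BP : B *m lin_mx f = B.
  apply/row_matrixP => i; rewrite row_mul rowK mul_vec_lin fK //.
  by rewrite vbasis_mem // mem_nth // size_tuple.
have freeB : row_free B.
  rewrite -kermx_eq0; apply/rowV0P => u /sub_kermxP uB0.
  have /freeP freeX : free X by apply: basis_free; apply: vbasisP.
  apply/rowP => i; rewrite mxE; apply: (freeX (u 0)).
  apply: (can_inj mxvecK); rewrite linear0 -uB0 mulmx_sum_row linear_sum.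
  by apply: eq_bigr => j _; rewrite linearZ rowK.
(* [B *m C *m B = B] since the projector fixes the basis; the rows of [B] are free, so [B] cancels
   on the right. *)
have BC1 : B *m C = 1%:M.
  by apply: (row_free_inj freeB); rewrite /= -mulmxA -defP BP mul1mx.
by rewrite defP mxtrace_mulC BC1 mxtrace1.
Qed.

(** * Dimensions of Hom spaces as inner products of characters *)

Section CharacterProduct.

Variables (K : fieldType) (gT : finGroupType) (G : {group gT}).
Hypothesis cardG_neq0 : #|G|%:R != 0 :> K.
Implicit Types U W : representation K G.

(** The inner product of characters, with [g^-1] in place of complex conjugation so that it makes
    sense over a general field. *)
Definition char_prod U W : K :=
  #|G|%:R^-1 * \sum_(g in G) \tr (U g^-1%g) * \tr (W g).

Section Reynolds.

Variables U W : representation K G.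

Definition reynolds : 'M[K]_(rdegree U, rdegree W) -> 'M_(_, _) :=
  fun f => #|G|%:R^-1 *: \sum_(g in G) U g^-1%g *m f *m W g.

Fact reynolds_linear : linear reynolds.
Proof.
move=> a f h; rewrite /reynolds scalerA [a * _]mulrC -scalerA -scalerDr.
congr (_ *: _); rewrite scaler_sumr -big_split; apply: eq_bigr => g _ /=.
by rewrite mulmxDr mulmxDl -scalemxAr -scalemxAl.
Qed.
HB.instance Definition _ := GRing.isSemilinear.Build K _ _ _ reynolds
  (GRing.semilinear_linear reynolds_linear).

Lemma reynolds_hom f : reynolds f \in homG U W.
Proof.
apply/homGP => x Gx; rewrite /reynolds -scalemxAl -scalemxAr; congr (_ *: _).
(* After replacing [g] by [g * x] on the left, [U x] cancels against part of [U (g * x)^-1] and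
   [W x] splits off on the right. *)
rewrite mulmx_sumr mulmx_suml [LHS](reindex_inj (mulIg x)) /=.
rewrite (eq_bigl (mem G)) => [|g]; last by rewrite /= groupMr.
apply: eq_bigr => g Gg.
by rewrite repr_mxM // !mulmxA -repr_mxM ?groupV ?groupM // invMg mulKVg.
Qed.

Lemma reynolds_id : {in homG U W, forall f, reynolds f = f}.
Proof.
move=> f /homGP Uf; rewrite /reynolds.
rewrite (eq_bigr (fun=> f)) => [|g Gg].
  by rewrite sumr_const -[f in RHS]scale1r -scaler_nat scalerA mulVf.
by rewrite -mulmxA -Uf // mulmxA -repr_mxM ?groupV // mulVg repr_mx1 mul1mx.
Qed.

Lemma mxtrace_reynolds : \tr (lin_mx reynolds) = char_prod U W.
Proof.
have -> : lin_mx reynolds = #|G|%:R^-1 *: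
    \sum_(g in G) lin_mx (mulmxr (W g) \o mulmx (U g^-1%g)).
  apply/row_matrixP => k; rewrite !rowE -[delta_mx 0 k]vec_mxK.
  rewrite mul_vec_lin -scalemxAr mulmx_sumr linearZ linear_sum /=.
  by congr (_ *: _); apply: eq_bigr => g _; rewrite mul_vec_lin.
rewrite mxtraceZ raddf_sum; congr (_ * _).
by apply: eq_bigr => g _; rewrite /= mxtrace_lin_mulmx.
Qed.

End Reynolds.

Lemma dim_homG U W : (\dim (homG U W))%:R = char_prod U W.
Proof.
rewrite -mxtrace_reynolds; apply/esym/mxtrace_proj_vspace.
- exact: reynolds_hom.
- exact: reynolds_id.
Qed.

End CharacterProduct.

(** * Schur's lemma *)

Section Schur.

Variables (K : fieldType) (gT : finGroupType) (G : {group gT}).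
Implicit Types U W : representation K G.

(** The kernel and the image of an intertwiner are submodules, so a nonzero one between irreducible
    modules is injective and surjective. *)
Lemma homG_rsim U W f :
    mx_irreducible U -> mx_irreducible W ->
    f \in homG U W -> f != 0 ->
  mx_rsim U W.
Proof.
move=> /mx_irrP[_ irrU] /mx_irrP[_ irrW] /homGP Uf nz_f.
have free_f : row_free f.
  rewrite -kermx_eq0; apply: contraR nz_f => nz_ker.
  have: row_full (kermx f).
    apply: irrU => //; apply/mxmoduleP => g Gg.
    apply/sub_kermxP.
    by rewrite -mulmxA Uf // mulmxA mulmx_ker mul0mx.
  by rewrite -sub1mx => /sub_kermxP <-; rewrite mul1mx.
have full_f : row_full f.
  (* Irreducibility speaks of submodules given by square matrices, so the image of [f] is
     represented by its square generator. *)
  rewrite -(eq_row_full (genmxE f)); apply: irrW; last first.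
  by rewrite -mxrank_eq0 genmxE mxrank_eq0.
  apply/mxmoduleP => g Gg; rewrite genmxE (eqmxMr _ (genmxE f)) -Uf //.
  exact: submxMl.
by exists f => //; rewrite -(eqP free_f) (eqP full_f).
Qed.

(** Over a splitting field an irreducible module is absolutely irreducible, so only scalar matrices
    commute with the action. *)
Lemma dim_homG_irr U :
    group_splitting_field K G -> mx_irreducible U ->
  \dim (homG U U) = 1%N.
Proof.
move=> splitG irrU; have [n_gt0 _] := (mx_irrP U).1 irrU.
suffices -> : homG U U = <[1%:M]>%VS.
  rewrite dim_vline; case: eqP => // /eqP; rewrite -mxrank_eq0 mxrank1.
  by rewrite -leqn0 leqNgt n_gt0.
apply/vspaceP => f; apply/homGP/vlineP => [Uf | [a ->] g Gg].
  have /is_scalar_mxP[a ->] : is_scalar_mx f.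
    apply: mx_abs_irr_cent_scalar (splitG _ U irrU) _ _.
    by apply/centgmxP => g Gg; rewrite Uf.
  by exists a; rewrite scalemx1.
by rewrite scalemx1 scalar_mxC.
Qed.

Lemma dim_homG_irr_nrsim U W :
    mx_irreducible U -> mx_irreducible W -> ~ mx_rsim U W ->
  \dim (homG U W) = 0%N.
Proof.
move=> irrU irrW nUW; apply/eqP; rewrite dimv_eq0 -subv0; apply/subvP => f fUW.
rewrite memv0; apply/negPn/negP => nz_f.
by apply: nUW; apply: homG_rsim nz_f.
Qed.

End Schur.

(** * Irreducible characters and the recursion for the multiplicities *)

Section Characters.

Variables (K : fieldType) (gT : finGroupType) (G : {group gT}).
Implicit Types U V W : representation K G.

Lemma mxtrace_dsum (I : finType) (W : I -> representation K G) g :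
  \tr ((\big[@dadd_grepr K gT G/grepr0]_i W i) g) = \sum_i \tr (W i g).
Proof.
apply: (big_morph (fun U : representation K G => \tr (U g))) => [U1 U2|].
  exact: mxtrace_block.
exact: mxtrace1.
Qed.

Lemma mxtrace_muln W n g : \tr (muln_grepr W n g) = \tr (W g) *+ n.
Proof. by rewrite mxtrace_dsum sumr_const card_ord. Qed.

Lemma mxtrace_dual V g : \tr (dual_grepr V g) = \tr (V g^-1%g).
Proof. exact: mxtrace_tr. Qed.

Lemma mxtraceJ V g x : g \in G -> x \in G -> \tr (V (g ^ x)%g) = \tr (V g).
Proof.
by move=> Gg Gx; rewrite !repr_mxM ?groupM ?groupV // mxtrace_mulC repr_mxK.
Qed.

Section System.

Variables (r : nat) (irr : 'I_r.+1 -> representation K G).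
Hypothesis irrP : irreducible_system irr.
Hypothesis cardG_neq0 : #|G|%:R != 0 :> K.
Hypothesis splitG : group_splitting_field K G.

Lemma irr_orthonormal l m : char_prod (irr l) (irr m) = (l == m)%:R.
Proof.
have [irr_irr irr_inj _ _] := irrP; rewrite -dim_homG //.
have [<- | ne_lm] := eqVneq; first by rewrite dim_homG_irr.
by rewrite dim_homG_irr_nrsim // => /irr_inj/eqP; rewrite (negbTE ne_lm).
Qed.

(** Sending [irr l] to its component in [sG] is a bijection, and over a splitting field of
    characteristic prime to the group order there are as many components as classes. This makes the
    character table square. *)
Lemma card_irreducible_system (sG : irrType K G) : #|classes G| = r.+1.
Proof.
have charG : pgroup ([pchar K]^')%N G by rewrite /pgroup -natf_neq0_pchar.
have [irr_irr irr_inj irr_all _] := irrP.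
rewrite -(card_irr_pchar sG charG splitG) -[r.+1]card_ord.
have irr_compE l := rsim_irr_comp_pchar sG charG (irr_irr l).
have inj_comp : injective (fun l => irr_comp sG (irr l)).
  move=> l m eq_lm; apply: irr_inj; apply: mx_rsim_trans (irr_compE l) _.
  by rewrite eq_lm; apply: mx_rsim_sym.
apply/esym; rewrite -(card_codom inj_comp); apply: eq_card => i; rewrite !inE.
have [l iso_il] := irr_all (Representation (irr_repr i)) (socle_irr i).
apply/codomP; exists l; rewrite -[LHS](irr_reprK_pchar charG).
exact: irr_comp_rsim_pchar iso_il.
Qed.

Section Graph.

Variables (V : representation K G) (A : 'M[nat]_r.+1).
Hypothesis AP : rep_graph_adjacency irr V A.

Lemma char_adjacency l g : g \in G ->
  \tr (irr l g) * \tr (V g) = \sum_j (A l j)%:R * \tr (irr j g).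
Proof.
move=> Gg; rewrite -mxtrace_prod; have := mxtrace_rsim (AP l) Gg => /= ->.
rewrite mxtrace_dsum; apply: eq_bigr => j _.
by rewrite mxtrace_muln mulr_natl.
Qed.

Lemma mult_tpower0 l : (mult_tpower (irr l) V 0)%:R = (l == ord0)%:R :> K.
Proof.
have [_ _ _ triv0] := irrP.
(* The Kronecker delta is read as the inner product with [irr ord0], which has the character of the
   trivial module. *)
rewrite -irr_orthonormal dim_homG //; congr (_ * _); apply: eq_bigr => g Gg.
by congr (_ * _); rewrite (mxtrace_rsim triv0).
Qed.

Lemma mult_tpowerS l k : mx_rsim (dual_grepr V) V ->
  (mult_tpower (irr l) V k.+1)%:R
    = \sum_j (A l j)%:R * (mult_tpower (irr j) V k)%:R :> K.
Proof.
move=> dualV; rewrite dim_homG //.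
under eq_bigr => j _ do rewrite dim_homG // /char_prod mulrCA.
rewrite -mulr_sumr; congr (_ * _).
under [RHS]eq_bigr => j _ do rewrite mulr_sumr.
rewrite exchange_big; apply: eq_bigr => g Gg /=.
under [RHS]eq_bigr => j _ do rewrite mulrA.
(* The graph relation at [g^-1] produces the factor [\tr (V g^-1)], which self-duality turns into
   [\tr (V g)], the last factor of the tensor power. *)
rewrite -mulr_suml -char_adjacency ?groupV // -(mxtrace_dual V).
by rewrite (mxtrace_rsim dualV) // mxtrace_prod -mulrA [\tr (V g) * _]mulrC.
Qed.

End Graph.

End System.

End Characters.

(** * Coefficients and units of power series *)

Section PowerSeries.

Variable K : fieldType.
Implicit Types f g : fps K.

Fact fpsC_zmod_morphism : zmod_morphism (@fpsC K).
Proof. by move=> a b; apply: fpsP => -[|n] //=; rewrite subr0. Qed.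
Fact fpsC_monoid_morphism : monoid_morphism (@fpsC K).
Proof.
split=> // a b; apply: fpsP => -[|n] /=; first by rewrite big_ord1.
by rewrite big_ord_recl big1 /= ?mulr0 ?addr0 // => i _; rewrite mul0r.
Qed.
(** As a ring morphism, [fpsC] transports matrix identities and determinants from [K] to power
    series. *)
HB.instance Definition _ :=
  GRing.isZmodMorphism.Build K (fps K) (@fpsC K) fpsC_zmod_morphism.
HB.instance Definition _ :=
  GRing.isMonoidMorphism.Build K (fps K) (@fpsC K) fpsC_monoid_morphism.

Lemma fps_coefB f g n : fps_coef (f - g) n = fps_coef f n - fps_coef g n.
Proof. by []. Qed.

Lemma fps_coef_sum (I : Type) (s : seq I) (P : pred I) (F : I -> fps K) n :
  fps_coef (\sum_(i <- s | P i) F i) n = \sum_(i <- s | P i) fps_coef (F i) n.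
Proof. exact: (big_morph (fun f => fps_coef f n)). Qed.

Lemma fps_coefCM (c : K) f n : fps_coef (fpsC c * f) n = c * fps_coef f n.
Proof.
rewrite [LHS]big_ord_recl big1 /= ?addr0 ?subn0 // => i _.
by rewrite mul0r.
Qed.

Lemma fps_coefXM f n :
  fps_coef (fpsX * f) n = if n is k.+1 then fps_coef f k else 0.
Proof.
case: n => [|n]; first by rewrite [LHS]big_ord1 mul0r.
rewrite [LHS]big_ord_recl mul0r add0r big_ord_recl big1 ?addr0 => [|i _].
  by rewrite /= mul1r subn1.
by rewrite /= mul0r.
Qed.

Lemma one_sub_CX_unit (c : K) : 1 - fpsC c * fpsX \is a GRing.unit.
Proof.
by rewrite mulrC; apply/eqP => /eqP; rewrite /= big_ord1 mul0r subr0 oner_eq0.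
Qed.

End PowerSeries.

(** * Cramer's rule for [I - tA] *)

Lemma one_sub_tAE (K : fieldType) r (A : 'M[nat]_r.+1) :
  one_sub_tA K A
    = 1%:M - fpsX *: map_mx (@fpsC K) (map_mx (fun a : nat => a%:R) A).
Proof.
by congr (_ - _ *: _); apply/matrixP => i j; rewrite !mxE rmorph_nat.
Qed.

(** Multiplying the system by the adjugate of [B] turns the right-hand side into its entry
    [(mu, ord0)], the cofactor left by expanding the replaced matrix along column [mu]. *)
Lemma det_column_replaced (K : fieldType) r (A : 'M[nat]_r.+1)
    (x : 'cV[fps K]_r.+1) mu :
    one_sub_tA K A *m x = delta_mx ord0 0 ->
  \det (column_replaced K A mu) = \det (one_sub_tA K A) * x mu 0.
Proof.
move=> Bx; set B := one_sub_tA K A in Bx *.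
have -> : \det B * x mu 0 = (\adj B *m (delta_mx ord0 0 : 'cV_r.+1)) mu 0.
  by rewrite -Bx mulmxA mul_adj_mx mul_scalar_mx mxE.
rewrite -colE !mxE (expand_det_col _ mu) (bigD1 ord0) //= big1 => [|i].
  (* The minor omits column [mu], the only one in which the two matrices differ. *)
  rewrite mxE !eqxx mul1r addr0 /cofactor; congr (_ * \det _).
  by apply/matrixP => i j; rewrite !mxE eq_sym (negbTE (neq_lift _ _)).
by move=> /negbTE ne_i; rewrite mxE eqxx ne_i mul0r.
Qed.

(** * The linear system for the series and the product formula for the determinant *)

Section Determinant.

Variables (K : fieldType) (gT : finGroupType) (G : {group gT}).
Variables (r : nat) (irr : 'I_r.+1 -> representation K G).
Hypothesis irrP : irreducible_system irr.
Hypothesis cardG_neq0 : #|G|%:R != 0 :> K.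
Hypothesis splitG : group_splitting_field K G.
Variables (V : representation K G) (A : 'M[nat]_r.+1).
Hypothesis AP : rep_graph_adjacency irr V A.

Lemma one_sub_tA_poincare : mx_rsim (dual_grepr V) V ->
  one_sub_tA K A *m \col_l poincare_series (irr l) V = delta_mx ord0 0.
Proof.
move=> dualV; rewrite one_sub_tAE mulmxBl mul1mx -scalemxAl.
apply/colP => l; rewrite !mxE eqxx andbT; apply: fpsP => n.
(* In degree 0 the term in [t] vanishes and the initial multiplicities give the delta vector; in
   degree [n.+1] the recursion cancels the two terms. *)
rewrite fps_coefB fps_coefXM; case: n => [|n].
  by rewrite subr0 /= (mult_tpower0 irrP) //; case: (l == _).
rewrite fps_coef_sum.
rewrite [fps_coef (poincare_series _ _) _](mult_tpowerS cardG_neq0 AP) //.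
under [X in _ - X]eq_bigr => j _ do rewrite !mxE fps_coefCM.
by rewrite subrr; case: (l == _).
Qed.

(** A row in the left kernel is a combination of irreducible characters vanishing at every [e i],
    hence on all of [G] by conjugation invariance; orthonormality then kills its coefficients. *)
Lemma character_table_unit (e : 'I_r.+1 -> gT) :
    (forall i, e i \in G) ->
    (forall g, g \in G -> exists i, exists2 x, x \in G & g = (e i ^ x)%g) ->
  (\matrix_(l, i) \tr (irr l (e i))) \in unitmx.
Proof.
move=> Ge eP; rewrite -row_free_unit -kermx_eq0; apply/rowV0P => u.
move=> /sub_kermxP uX0; apply/rowP => l; rewrite mxE.
have u0 g : g \in G -> \sum_j u 0 j * \tr (irr j g) = 0.
  move=> /eP[i [x Gx ->]]; have := congr1 (fun v : 'rV_ _ => v 0 i) uX0.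
  rewrite !mxE => uXi0; rewrite -[RHS]uXi0; apply: eq_bigr => j _.
  by rewrite mxtraceJ // mxE.
have -> : u 0 l = \sum_j u 0 j * char_prod (irr l) (irr j).
  rewrite (bigD1 l) //= irr_orthonormal // eqxx mulr1 big1 ?addr0 // => j.
  by rewrite eq_sym irr_orthonormal // => /negbTE ->; rewrite mulr0.
under eq_bigr => j _ do rewrite /char_prod mulrCA.
rewrite -mulr_sumr.
under eq_bigr => j _ do rewrite mulr_sumr.
rewrite exchange_big big1 ?mulr0 // => g Gg /=.
under eq_bigr => j _ do rewrite mulrCA.
by rewrite -mulr_sumr u0 ?mulr0.
Qed.

Lemma det_one_sub_tA (e : 'I_r.+1 -> gT) :
    (forall i, e i \in G) ->
    (forall g, g \in G -> exists i, exists2 x, x \in G & g = (e i ^ x)%g) ->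
  \det (one_sub_tA K A) = \prod_i (1 - fpsC (\tr (V (e i))) * fpsX).
Proof.
move=> Ge eP; have unitX := character_table_unit Ge eP.
set X := (\matrix_(l, i) _) in unitX.
pose chiV := \row_i \tr (V (e i)).
have AX : map_mx (fun a : nat => a%:R) A *m X = X *m diag_mx chiV.
  apply/matrixP => l i; rewrite mul_mx_diag !mxE (char_adjacency AP) //.
  by apply: eq_bigr => j _; rewrite !mxE.
have BX : one_sub_tA K A *m map_mx (@fpsC K) X
    = map_mx (@fpsC K) X *m diag_mx (\row_i (1 - fpsC (\tr (V (e i))) * fpsX)).
  rewrite one_sub_tAE mulmxBl mul1mx -scalemxAl -map_mxM AX map_mxM.
  apply/matrixP => l i.
  by rewrite map_diag_mx !mul_mx_diag !mxE mulrBr mulr1 mulrCA [fpsX * _]mulrC.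
(* The determinant of [X] is a nonzero constant, so it stays invertible among power series and
   cancels from both sides. *)
have unitdetX : \det (map_mx (@fpsC K) X) \is a GRing.unit.
  by rewrite det_map_mx rmorph_unit.
apply: (mulIr unitdetX); rewrite -det_mulmx BX det_mulmx mulrC det_diag.
by congr (_ * _); apply: eq_bigr => i _; rewrite mxE.
Qed.

Lemma det_one_sub_tA_transversal (sG : irrType K G) (Gamma : {set gT}) :
    is_transversal Gamma (classes G) G ->
  \det (one_sub_tA K A) = \prod_(g in Gamma) (1 - fpsC (\tr (V g)) * fpsX).
Proof.
move=> GammaP; have cardGamma : #|Gamma| = r.+1.
  by rewrite (card_transversal GammaP) (card_irreducible_system irrP).
(* The equality of cardinals lets the indices of the irreducible modules enumerate [Gamma]. *)
pose e i := enum_val (cast_ord (esym cardGamma) i).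
rewrite (@det_one_sub_tA e) => [|i|g Gg].
- rewrite [RHS]big_enum_val; apply/esym.
  rewrite (reindex (cast_ord (esym cardGamma))) //.
  exact/onW_bij/(Bijective (cast_ordK _) (cast_ordKV _)).
- exact: (subsetP (transversal_sub GammaP)) (enum_valP _).
(* The representative in [Gamma] of the class of [g] gives the index, and an element conjugating it
   to [g] the second witness. *)
have Cg : (g ^: G)%g \in classes G by apply: imset_f.
have xGamma := repr_mem_transversal GammaP g Cg.
have := repr_mem_pblock GammaP g Cg.
set x := transversal_repr _ _ _ in xGamma *.
rewrite class_sym => /imsetP[y Gy ->].
exists (cast_ord cardGamma (enum_rank_in xGamma x)), y => //.
by rewrite /e cast_ordK enum_rankK_in.
Qed.

End Determinant.

Theorem theorem2p1 (R : realType) (gT : finGroupType) (G : {group gT})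
    (r : nat) (irr : 'I_r.+1 -> representation R[i] G)
    (irrP : irreducible_system irr)
    (V : representation R[i] G)
    (V_faithful : mx_faithful V)
    (V_selfdual : mx_rsim (dual_grepr V) V)
    (A : 'M[nat]_r.+1) (AP : rep_graph_adjacency irr V A)
    (Gamma : {set gT}) (GammaP : is_transversal Gamma (classes G) G)
    (mu : 'I_r.+1) :
  poincare_series (irr mu) V
    = \det (column_replaced R[i] A mu) / \det (one_sub_tA R[i] A)
  /\
  \det (column_replaced R[i] A mu) / \det (one_sub_tA R[i] A)
    = \det (column_replaced R[i] A mu)
      / \prod_(g in Gamma) (1 - fpsC (\tr (V g)) * fpsX).
Proof.
have cardG_neq0 : #|G|%:R != 0 :> R[i].
  by rewrite Num.Theory.pnatr_eq0 -lt0n cardG_gt0.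
(* The field [R[i]] is algebraically closed, hence splits [G]. *)
have splitG : group_splitting_field R[i] G := @group_closure_closed_field _ _ G.
have detE := det_one_sub_tA_transversal irrP cardG_neq0 splitG AP
  (DecSocleType _) GammaP.
split; last by rewrite detE.
(* Each factor has constant term 1. Invertibility matters because [fps_inv] returns a non-unit
   unchanged. *)
have unit_det : \det (one_sub_tA R[i] A) \is a GRing.unit.
  by rewrite detE; apply: rpred_prod => g _; apply: one_sub_CX_unit.
have Bm := one_sub_tA_poincare irrP cardG_neq0 splitG AP V_selfdual.
rewrite (det_column_replaced mu Bm).
by rewrite mxE mulrAC divrr ?mul1r.
Qed.
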